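(* Let $G$ be an infinite group with $G \neq G'$, let $\mathbf{R}$ be either the ring $\mathbb{Z}$ of integers or the ring $\mathbb{Z}_{p^{\infty}}$ of $p$-adic integers ($p$ a prime), and let $A$ be an $\mathbf{R}G$-module with $C_G(A)=1$. Suppose that $A/C_A(G)$ is not an artinian $\mathbf{R}$-module and that $A/C_A(H)$ is an artinian $\mathbf{R}$-module for every proper subgroup $H$ of $G$. Then $G$ is isomorphic to a quasi-cyclic $q$-group $C_{q^{\infty}}$ for some prime $q$.
   Context: $G'$ denotes the derived (commutator) subgroup of $G$. For a module $A$ over the group ring $\mathbf{R}G$ and a subgroup $H \le G$, $C_A(H)=\{a\in A : ah=a \text{ for all } h\in H\}$, which is an $\mathbf{R}$-submodule of $A$, and $C_G(A)=\{g\in G : ag=a \text{ for all } a\in A\}$. An $\mathbf{R}$-module is artinian if the partially ordered set of its submodules satisfies the minimal (descending chain) condition. In this paper $\mathbb{Z}_{p^{\infty}}$ denotes the ring of $p$-adic integers. The quasi-cyclic $q$-group $C_{q^{\infty}}$ is the Prüfer $q$-group, i.e. the $q$-primary component of $\mathbb{Q}/\mathbb{Z}$. *)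

(* Defs.v *)
From HB Require Import structures.
From mathcomp Require Import all_boot all_order all_algebra.
From mathcomp Require Import boolp classical_sets functions cardinality.

Set Implicit Arguments.
Unset Strict Implicit.
Unset Printing Implicit Defensive.

Import GRing.Theory.
Local Open Scope classical_set_scope.
Local Open Scope ring_scope.
Local Open Scope quotient_scope.

Section Groups.
Variable G : groupType.

Definition is_subgroup (H : set G) : Prop := group_closed (mem H).

Definition proper_subgroup (H : set G) : Prop :=
  is_subgroup H /\ H <> [set: G].

Definition commutators : set G := [set z | exists x y : G, z = [~ x, y]%g].

Definition derived_subgroup : set G := smallest is_subgroup commutators.

End Groups.

Arguments derived_subgroup : clear implicits.

(* The ring of p-adic integers, as the inverse limit of the rings Z/p^(n+1).
   The ring 'Z_(p ^ n.+1) is Z/p^(n+1) as soon as p > 1, and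
   (x : nat)%:R : 'Z_d is the class modulo d of the representative of x. *)
Section PadicIntegers.
Variable p : nat.

Record padic_int : Type := PadicInt {
  padic_mod :> forall n, 'Z_(p ^ n.+1);
  padic_coherent : forall n, (padic_mod n.+1 : nat)%:R = padic_mod n
}.

Lemma padic_ext (x y : padic_int) : (forall n, x n = y n) -> x = y.
Proof.
case: x y => [x xP] [y yP] /= xy.
have {}xy : x = y by apply: functional_extensionality_dep.
by subst y; congr PadicInt; apply: Prop_irrelevance.
Qed.

HB.instance Definition _ := gen_eqMixin padic_int.
HB.instance Definition _ := gen_choiceMixin padic_int.

Let dvd_step n :
  ((Zp_trunc (p ^ n.+1)).+2 %| (Zp_trunc (p ^ n.+2)).+2)%N.
Proof.
case: (ltnP 1 p) => [p_gt1|].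
  have p_n m : (1 < p ^ m.+1)%N by rewrite -(exp1n m.+1) ltn_exp2r.
  by rewrite !Zp_cast // (expnS p n.+1) dvdn_mull.
by case: p => [|[|//]] _; rewrite ?exp1n // !exp0n.
Qed.

Let red n (k : nat) :
  ((k %% (Zp_trunc (p ^ n.+2)).+2)%N)%:R = k%:R :> 'Z_(p ^ n.+1).
Proof. by apply: val_inj; rewrite /= !Zp_nat /= modn_dvdm. Qed.

Let coh_cst (k : nat) n :
  (nat_of_ord (k%:R : 'Z_(p ^ n.+2))%R)%:R = k%:R :> 'Z_(p ^ n.+1).
Proof. by rewrite [X in nat_of_ord X]Zp_nat /= red. Qed.

Let coh_add (x y : padic_int) n :
  (nat_of_ord (x n.+1 + y n.+1)%R)%:R = x n + y n.
Proof. by rewrite /= red natrD !padic_coherent. Qed.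

Let coh_mul (x y : padic_int) n :
  (nat_of_ord (x n.+1 * y n.+1)%R)%:R = x n * y n.
Proof. by rewrite /= red natrM !padic_coherent. Qed.

Let coh_opp (x : padic_int) n :
  (nat_of_ord (- x n.+1)%R)%:R = - x n.
Proof.
apply/eqP; rewrite -addr_eq0 -[X in _ + X]padic_coherent -natrD -red.
by rewrite -[(_ %% _)%N]/(nat_of_ord (- x n.+1 + x n.+1)%R) addNr.
Qed.

Definition padic_zero := @PadicInt (fun n => 0%:R) (coh_cst 0).
Definition padic_one := @PadicInt (fun n => 1%:R) (coh_cst 1).
Definition padic_add (x y : padic_int) :=
  @PadicInt (fun n => x n + y n) (coh_add x y).
Definition padic_opp (x : padic_int) :=
  @PadicInt (fun n => - x n) (coh_opp x).
Definition padic_mul (x y : padic_int) :=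
  @PadicInt (fun n => x n * y n) (coh_mul x y).

Let padic_addA : associative padic_add.
Proof. by move=> x y z; apply: padic_ext => n /=; rewrite addrA. Qed.
Let padic_addC : commutative padic_add.
Proof. by move=> x y; apply: padic_ext => n /=; rewrite addrC. Qed.
Let padic_add0 : left_id padic_zero padic_add.
Proof. by move=> x; apply: padic_ext => n /=; rewrite add0r. Qed.
Let padic_addN : left_inverse padic_zero padic_opp padic_add.
Proof. by move=> x; apply: padic_ext => n /=; rewrite addNr. Qed.

HB.instance Definition _ :=
  GRing.isZmodule.Build padic_int padic_addA padic_addC padic_add0 padic_addN.

Let padic_mulA : associative padic_mul.
Proof. by move=> x y z; apply: padic_ext => n /=; rewrite mulrA. Qed.
Let padic_mulC : commutative padic_mul.
Proof. by move=> x y; apply: padic_ext => n /=; rewrite mulrC. Qed.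
Let padic_mul1 : left_id padic_one padic_mul.
Proof. by move=> x; apply: padic_ext => n /=; rewrite mul1r. Qed.
Let padic_mulD : left_distributive padic_mul padic_add.
Proof. by move=> x y z; apply: padic_ext => n /=; rewrite mulrDl. Qed.
Let padic_1neq0 : padic_one != 0.
Proof.
apply/eqP => /(congr1 (fun x : padic_int => x 0%N)) /= /eqP.
by rewrite oner_eq0.
Qed.

HB.instance Definition _ := GRing.Zmodule_isComNzRing.Build padic_int
  padic_mulA padic_mulC padic_mul1 padic_mulD padic_1neq0.

End PadicIntegers.

Section QuotientModule.
Variables (R : nzRingType) (V : lmodType R) (S : submodClosed V).

Definition submod_pred : {pred V} := fun v => v \in S.

Let submod_pred_zmod : zmod_closed submod_pred.
Proof.
split=> [|x y xS yS]; first exact: (rpred0 S).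
rewrite -scaleN1r -[_ \in _]/(x + -1 *: y \in S).
by apply: rpredD => //; apply: rpredZ.
Qed.

HB.instance Definition _ := GRing.isZmodClosed.Build V submod_pred
  submod_pred_zmod.

Definition quot_mod := Quotient.quot submod_pred.

HB.instance Definition _ := EqQuotient.on quot_mod.
HB.instance Definition _ := GRing.Zmodule.on quot_mod.

Definition quot_scale (c : R) (u : quot_mod) : quot_mod :=
  \pi_quot_mod (c *: repr u).

Lemma quot_scale_pi c v : quot_scale c (\pi_quot_mod v) = \pi_quot_mod (c *: v).
Proof.
apply/eqP; rewrite -Quotient.idealrBE -scalerBr; apply: rpredZ.
by rewrite -[_ \in S]/(_ \in submod_pred) Quotient.idealrBE reprK.
Qed.

Let quot_scaleA c d u : quot_scale c (quot_scale d u) = quot_scale (c * d) u.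
Proof. by rewrite -[u]reprK (quot_scale_pi d) !quot_scale_pi scalerA. Qed.
Let quot_scale1 : left_id 1 quot_scale.
Proof. by move=> u; rewrite -[u]reprK quot_scale_pi scale1r. Qed.
Let quot_scaleDr : right_distributive quot_scale +%R.
Proof.
move=> c u v; rewrite -[u]reprK -[v]reprK -[_ + _]raddfD.
by rewrite !quot_scale_pi scalerDr raddfD.
Qed.
Let quot_scaleDl u : {morph quot_scale^~ u : c d / c + d}.
Proof. by move=> c d; rewrite -[u]reprK !quot_scale_pi scalerDl raddfD. Qed.

HB.instance Definition _ := GRing.Zmodule_isLmodule.Build R quot_mod
  quot_scaleA quot_scale1 quot_scaleDr quot_scaleDl.

End QuotientModule.

Definition artinian (R : nzRingType) (M : lmodType R) : Prop :=
  forall S : nat -> set M,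
    (forall n, submod_closed (mem (S n))) ->
    (forall n, S n.+1 `<=` S n) ->
    exists N, forall n, (N <= n)%N -> S n = S N.

(* A right RG-module over a commutative ring R, given by its underlying
   R-module and the R-linear right action of the group G. *)
Record grmodType (R : comNzRingType) (G : groupType) : Type := GrModType {
  grmod_carrier :> lmodType R;
  gract : grmod_carrier -> G -> grmod_carrier;
  gract_linear : forall g, linear (gract^~ g);
  gract1 : forall a, gract a 1%g = a;
  gractM : forall a g h, gract a (g * h)%g = gract (gract a g) h
}.

Section Centralizers.
Variables (R : comNzRingType) (G : groupType) (A : grmodType R G).

Definition cent_mod (H : set G) : {pred A} :=
  fun a => `[< forall h, H h -> gract a h = a >].

Definition cent_group : set G := [set g | forall a : A, gract a g = a].

Let cent_mod_submod (H : set G) : submod_closed (cent_mod H).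
Proof.
have act0 g : gract (0 : A) g = 0.
  have /(congr1 (+%R (- gract 0 g))) := gract_linear g 1 (0 : A) 0.
  by rewrite !scale1r addr0 addNr addKr => <-.
split=> [|c a b /asboolP aH /asboolP bH]; apply/asboolP => h Hh //.
by rewrite gract_linear aH ?bH.
Qed.

HB.instance Definition _ (H : set G) :=
  GRing.isSubmodClosed.Build R A (cent_mod H) (cent_mod_submod H).

End Centralizers.

Arguments cent_mod {R G} A H.

Definition rat_int : {pred rat} := fun x => x \is a Num.int.

Fact rat_int_zmod : zmod_closed rat_int.
Proof. by split=> [|x y]; [exact: rpred0 | exact: rpredB]. Qed.

HB.instance Definition _ := GRing.isZmodClosed.Build rat rat_int rat_int_zmod.

Definition rat_mod_int : zmodType := Quotient.quot rat_int.

Section QuasiCyclic.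
Variable q : nat.

Definition primary_pred : {pred rat_mod_int} :=
  fun x => `[< exists n, x *+ (q ^ n) = 0 >].

Let primary_zmod : zmod_closed primary_pred.
Proof.
split=> [|x y /asboolP[n xn] /asboolP[m ym]]; apply/asboolP.
  by exists 0%N; rewrite mul0rn.
exists (n + m)%N; rewrite expnD mulrnBl mulrnA xn mul0rn sub0r.
by rewrite mulnC mulrnA ym mul0rn oppr0.
Qed.

HB.instance Definition _ :=
  GRing.isZmodClosed.Build rat_mod_int primary_pred primary_zmod.

Definition quasi_cyclic := {x : rat_mod_int | x \in primary_pred}.

HB.instance Definition _ := SubChoice.on quasi_cyclic.
HB.instance Definition _ := [SubChoice_isSubZmodule of quasi_cyclic by <:].

End QuasiCyclic.

(* The first group is written multiplicatively, the second additively. *)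
Definition group_isomorphic (G : groupType) (Z : zmodType) : Prop :=
  exists f : G -> Z, {morph f : x y / (x * y)%g >-> x + y} /\ bijective f.

(* Main.v *)
Require Import Defs.
From HB Require Import structures.
From mathcomp Require Import all_boot all_order all_algebra.
From mathcomp Require Import boolp classical_sets functions cardinality.
From mathcomp Require Import ring zify.
Local Open Scope classical_set_scope.
Local Open Scope ring_scope.

Set Implicit Arguments.
Unset Strict Implicit.
Unset Printing Implicit Defensive.
Import Order.TTheory GRing.Theory Num.Theory.

(** The fixed points of the subgroup generated by [H] and [K] are the common
    fixed points of [H] and [K], and a quotient by an intersection of two
    submodules embeds in the sum of the two quotients. Hence two proper
    subgroups never generate [G] ([artinian_join_proper]), and the proof has
    two parts.

    [G] is commutative. This is clear if [G] is cyclic. Otherwise adjoining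
    finitely many elements to a proper subgroup leaves it proper, so [G] has no
    proper subgroup of finite index ([finite_index_full]). Let [H] be a proper
    normal subgroup. In the artinian quotient [A / C_A(H)] every element has
    finite order and the [l]-torsion is finite for the relevant primes [l]
    ([int_artinian_torsion], [padic_artinian_torsion],
    [finite_prime_torsion]); so [G] has finite orbits there, and acts
    trivially ([artinian_trivial_action]). When [G] is not perfect, the
    derived subgroup together with any single element [x] generates a proper
    normal subgroup; therefore [x] fixes [a g - a] for all [a] and [g], and
    [a g x = a g + a x - a] is symmetric in [g] and [x]. The action being
    faithful, [G] is commutative ([artinian_commute]).

    A commutative infinite group [V] that is not the sum of two proper subgroups
    is quasi-cyclic ([hollow_Prufer]). The tool is a subgroup maximal among those
    avoiding a given element ([max_avoiding_submodule]). It shows that [V] is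
    a [q]-group for a single prime [q] ([hollow_primary]), that it is divisible
    ([hollow_divisible]), and that a quasi-cyclic subgroup of [V], generated by
    successive [q]-th roots of an element of order [q], has a complement; so
    this subgroup is [V]. *)

(** * Submodules and artinian quotients *)

Section Submodules.
Variables (R : nzRingType) (M : lmodType R).
Implicit Types (S T U X : set M) (u v x y : M) (r : R).

Definition is_submodule S : Prop :=
  S 0 /\ forall r u v, S u -> S v -> S (r *: u + v).

Lemma submod_closedE S : submod_closed (mem S) <-> is_submodule S.
Proof.
split=> -[S0 SD]; split=> [|r u v Su Sv].
- by rewrite -in_setE.
- by rewrite -in_setE; apply: SD; rewrite in_setE.
- by rewrite in_setE.
- by move: Su Sv; rewrite !in_setE; apply: SD.
Qed.

Lemma submodule0 S : is_submodule S -> S 0. Proof. by case. Qed.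

Lemma submoduleZ S r u : is_submodule S -> S u -> S (r *: u).
Proof. by move=> [S0 SD] Su; rewrite -[_ *: _]addr0; apply: SD. Qed.

Lemma submoduleD S u v : is_submodule S -> S u -> S v -> S (u + v).
Proof. by move=> [S0 SD] Su Sv; rewrite -[u]scale1r; apply: SD. Qed.

Lemma submoduleN S u : is_submodule S -> S u -> S (- u).
Proof. by rewrite -scaleN1r; apply: submoduleZ. Qed.

Lemma submoduleB S u v : is_submodule S -> S u -> S v -> S (u - v).
Proof. by move=> ? ? ?; apply: submoduleD => //; apply: submoduleN. Qed.

Lemma submoduleMn S u n : is_submodule S -> S u -> S (u *+ n).
Proof. by rewrite -scaler_nat; apply: submoduleZ. Qed.

Definition sum_set S T : set M :=
  [set v | exists2 s, S s & exists2 t, T t & v = s + t].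
Definition line x : set M := [set v | exists r, v = r *: x].

Lemma zero_submodule : is_submodule [set (0 : M)].
Proof. by split=> [//|r _ _ -> ->]; rewrite scaler0 addr0. Qed.

Lemma line_submodule x : is_submodule (line x).
Proof.
split=> [|r _ _ [a ->] [b ->]]; first by exists 0; rewrite scale0r.
by exists (r * a + b); rewrite scalerDl scalerA.
Qed.

Lemma sum_submodule S T :
  is_submodule S -> is_submodule T -> is_submodule (sum_set S T).
Proof.
move=> [S0 SD] [T0 TD]; split; first by exists 0 => //; exists 0; rewrite ?addr0.
move=> r _ _ [s Ss [t Tt ->]] [s' Ss' [t' Tt' ->]].
exists (r *: s + s'); first exact: SD.
by exists (r *: t + t'); [exact: TD|rewrite scalerDr addrACA].
Qed.

Lemma setI_submodule S T :
  is_submodule S -> is_submodule T -> is_submodule (S `&` T).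
Proof.
move=> [S0 SD] [T0 TD]; split=> // r u v [Su Tu] [Sv Tv].
by split; [exact: SD|exact: TD].
Qed.

Lemma sum_setl S T : is_submodule T -> S `<=` sum_set S T.
Proof. by move=> [T0 _] s Ss; exists s => //; exists 0; rewrite ?addr0. Qed.

(** Modulo the submodule [U], the class of [x] lies in every nonzero
    submodule: [x] is a multiple of every [y] outside [U]. The Zorn argument
    allows the empty set besides the submodules of interest, since the union
    of the empty chain is empty. *)
Lemma max_avoiding_submodule S x : is_submodule S -> ~ S x ->
  exists U, [/\ is_submodule U, S `<=` U, ~ U x &
    forall y, ~ U y -> exists2 u, U u & exists r, x = u + r *: y].
Proof.
move=> subS Sx.
pose P U := [/\ is_submodule U, S `<=` U & ~ U x] \/ U = set0.
have [F FP totF|U [PU maxU]] := @Zorn_bigcup M P.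
  have [[X0 FX0 X0_n0]|F0] := pselect (exists2 X, F X & X <> set0); last first.
    right; rewrite bigcup0 // => X FX.
    by apply: contrapT => X0; apply: F0; exists X.
  have FX X u : F X -> X u -> [/\ is_submodule X, S `<=` X & ~ X x].
    by move=> /FP[//|->].
  have [[X00 _] SX0 _] : [/\ is_submodule X0, S `<=` X0 & ~ X0 x].
    by case: (FP _ FX0).
  left; split; [split| |].
  - by exists X0.
  - move=> r u v [X FXX Xu] [Y FY Yv].
    have [XY|YX] := totF _ _ FXX FY.
      exists Y => //; have [[_ YD] _ _] := FX _ _ FY Yv.
      by apply: YD => //; apply: XY.
    exists X => //; have [[_ XD] _ _] := FX _ _ FXX Xu.
    by apply: XD => //; apply: YX.
  - by move=> s Ss; exists X0 => //; apply: SX0.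
  - by move=> [X FXX Xx]; have [_ _] := FX _ _ FXX Xx; apply.
have [[subU SU Ux]|U0] := PU; last first.
  have /(maxU S) : U `<` S.
    rewrite U0; split=> // /(_ 0); apply; exact: submodule0.
  by case; left; split.
exists U; split=> // y Uy.
apply: contrapT => nx; apply: (maxU (sum_set U (line y))).
  split; first exact: sum_setl (line_submodule y).
  move=> /(_ y) UU; apply/Uy/UU; exists 0; first exact: submodule0.
  by exists y; [exists 1; rewrite scale1r|rewrite add0r].
left; split; first exact: sum_submodule (line_submodule y).
  exact: subset_trans SU (sum_setl (line_submodule y)).
by move=> [u Uu [_ [r ->] xu]]; apply: nx; exists u => //; exists r.
Qed.

(** If no submodule satisfying [P] were minimal, dependent choice would build
    a strictly decreasing sequence of submodules. *)
Lemma artinian_minimal (P : set M -> Prop) : artinian M ->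
  (exists2 S, is_submodule S & P S) ->
  exists S, [/\ is_submodule S, P S &
    forall T, is_submodule T -> P T -> T `<=` S -> T = S].
Proof.
move=> art [S0 subS0 PS0]; apply: contrapT => nmin.
pose Q := {S | is_submodule S /\ P S}.
have step (S : Q) : {T : Q | sval T `<` sval S}.
  apply: cid; case: S => S [subS PS] /=; apply: contrapT => nT.
  apply: nmin; exists S; split=> // T subT PT TS.
  apply: contrapT => TneS; apply: nT; exists (exist _ T (conj subT PT)) => /=.
  by rewrite properEneq; split => //; apply/eqP.
pose X n : Q := iter n (fun T : Q => sval (step T)) (exist _ S0 (conj subS0 PS0)).
have X_lt n : sval (X n.+1) `<` sval (X n) by apply: (svalP (step (X n))).
have [n|n|N /(_ N.+1 (leqnSn N)) XN] := art (fun n => sval (X n)).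
- by apply/submod_closedE; case: (svalP (X n)).
- by case: (X_lt n).
- by have := X_lt N; rewrite XN; case.
Qed.

(** The chain condition of the quotient of [M] by [U], read in [M] itself so
    that several submodules [U] can be compared. *)
Definition artinian_above U : Prop := forall X : nat -> set M,
  (forall n, is_submodule (X n)) -> (forall n, U `<=` X n) ->
  (forall n, X n.+1 `<=` X n) ->
  exists N, forall n, (N <= n)%N -> X n = X N.

Lemma decreasing_subset (X : nat -> set M) : (forall n, X n.+1 `<=` X n) ->
  forall m n, (m <= n)%N -> X n `<=` X m.
Proof.
move=> Xdec m n /subnK <-; elim: (n - m)%N => [//|k IH].
by rewrite addSn; apply: subset_trans IH.
Qed.

(** The quotient by [S `&` T] embeds in the direct sum of the quotients by [S]
    and by [T]. Concretely, a chain [X n] above the intersection is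
    stationary as soon as [X n + S] and [(X n `&` S) + T] are. *)
Lemma artinian_above_setI S T : is_submodule S -> is_submodule T ->
  artinian_above S -> artinian_above T -> artinian_above (S `&` T).
Proof.
move=> subS subT artS artT X subX UX Xdec.
have sum_incl U V W : U `<=` V -> sum_set U W `<=` sum_set V W.
  by move=> UV _ [u Uu [w Ww ->]]; exists u; [exact: UV|exists w].
have sum_setr V W : is_submodule V -> W `<=` sum_set V W.
  by move=> [V0 _] w Ww; exists 0 => //; exists w; rewrite ?add0r.
have [|n|n|N1 XN1] := artS (fun n => sum_set (X n) S).
- by move=> n; apply: sum_submodule.
- exact: sum_setr.
- exact: sum_incl.
have [|n|n|N2 XN2] := artT (fun n => sum_set (X n `&` S) T).
- by move=> n; apply: sum_submodule => //; apply: setI_submodule.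
- by apply: sum_setr; apply: setI_submodule.
- by apply: sum_incl; apply: setSI.
pose N := maxn N1 N2; exists N => n Nn.
have [N1n N2n] : (N1 <= n)%N /\ (N2 <= n)%N by rewrite /N in Nn; lia.
have X_mono := decreasing_subset Xdec.
apply/seteqP; split; first exact: X_mono.
move=> x XNx.
have : sum_set (X n) S x.
  rewrite (XN1 _ N1n); apply: sum_setl => //.
  by apply: X_mono XNx; rewrite leq_maxl.
case=> [y Xy [s Ss x_ys]].
have XNs : X N s.
  rewrite (_ : s = x - y); last by rewrite x_ys addrC addKr.
  by apply: submoduleB => //; apply: X_mono Xy.
have : sum_set (X n `&` S) T s.
  rewrite (XN2 _ N2n); apply: sum_setl => //; split=> //.
  by apply: X_mono XNs; rewrite leq_maxr.
case=> [z [Xz Sz] [t Tt s_zt]].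
have Xt : X n t.
  apply: UX; split=> //; rewrite (_ : t = s - z).
    exact: submoduleB.
  by rewrite s_zt addrC addKr.
by rewrite x_ys s_zt; apply: submoduleD => //; apply: submoduleD.
Qed.

End Submodules.

Section Quotients.
Variables (R : nzRingType) (V : lmodType R) (C : submodClosed V).
Local Notation pi := (\pi_(quot_mod C))%qT.

Lemma pi_eq u v : (pi u = pi v) <-> (u - v \in C).
Proof.
rewrite -[_ \in C]/(_ \in submod_pred C) Quotient.idealrBE.
by split=> [->|/eqP].
Qed.

Lemma pi_eq0 u : pi u = 0 <-> u \in C.
Proof.
have -> : 0 = pi 0 by rewrite raddf0.
by rewrite pi_eq subr0.
Qed.

Lemma piZ r u : pi (r *: u) = r *: pi u.
Proof. by rewrite -[LHS](@quot_scale_pi _ _ C). Qed.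

Lemma pi_linear r u v : pi (r *: u + v) = r *: pi u + pi v.
Proof. by rewrite -piZ; exact: raddfD. Qed.

Lemma pi_surj (u : quot_mod C) : exists v, u = pi v.
Proof. by exists (repr u); rewrite reprK. Qed.

Lemma artinian_quotP :
  artinian (quot_mod C) <-> artinian_above [set v | v \in C].
Proof.
split=> art X.
  move=> subX CX Xdec.
  have [n|n|N XN] := art (fun n => pi @` X n).
  - apply/submod_closedE; split.
      by exists 0; [exact: submodule0|rewrite raddf0].
    move=> r _ _ [u Xu <-] [v Xv <-]; exists (r *: u + v).
      by case: (subX n) => _; apply.
    by rewrite pi_linear.
  - exact: image_subset.
  exists N => n /XN {}XN; apply/seteqP.
  suff imP m k : pi @` X m `<=` pi @` X k -> X m `<=` X k.
    by split; apply: imP; rewrite XN.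
  move=> imX u Xu; have [|v Xv /pi_eq vuC] := imX (pi u); first by exists u.
  (* u and v differ by an element of C, which is contained in X k *)
  rewrite -(subKr v u); apply: submoduleB => //; exact: CX.
move=> subX Xdec.
have [n|n|n|N XN] := art (fun n => pi @^-1` X n).
- have /submod_closedE[X0 XD] := subX n; split=> [|r u v Xu Xv].
    by rewrite /preimage /= raddf0.
  by rewrite -[_ _]/(X n (pi (r *: u + v))) pi_linear; apply: XD.
- move=> v vC /=; rewrite /preimage /= (proj2 (pi_eq0 v) vC).
  by apply: submodule0; apply/submod_closedE.
- exact: preimage_subset.
exists N => n /XN {}XN; apply/seteqP; split=> u; have [v ->] := pi_surj u.
  by rewrite -[X n _]/((pi @^-1` X n) v) XN.
by rewrite -[X N _]/((pi @^-1` X N) v) -XN.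
Qed.

End Quotients.

(** * Torsion in artinian modules over the integers and the p-adic integers *)

Lemma prime_inverse (l i : nat) : prime l -> ~~ (l %| i)%N ->
  exists a, (a * i = 1 %[mod l])%N.
Proof.
move=> l_pr; rewrite -prime_coprime // => co_li.
have i_gt0 : (0 < i)%N.
  by case: i co_li => //; rewrite prime_coprime // dvdn0.
case: (egcdnP l i_gt0) => a b ab _; exists a.
by rewrite ab gcdnC (eqP co_li) modnMDl.
Qed.

Lemma mulrn_mod (V : zmodType) (v : V) l n : v *+ l = 0 -> v *+ n = v *+ (n %% l).
Proof. by move=> v0; rewrite {1}(divn_eq n l) mulrnDr mulnC mulrnA v0 mul0rn add0r. Qed.

Section Torsion.
Variable R : comNzRingType.

(** Modulo [l], every scalar is an integer; hence on a module killed by [l] the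
    scalars act as integers. *)
Definition integral_mod (l : nat) : Prop :=
  forall x : R, exists i y, x = i%:R + l%:R * y.

(** Let [W] be minimal among the infinite submodules killed by [l], let [x] be
    a nonzero element of [W] and [U] a maximal submodule avoiding [x]. Since
    [W] is a vector space over the field with [l] elements, [U `&` W] is a
    hyperplane of [W], with complement spanned by [x]: it is proper, and it is
    infinite because it has finite index in [W], against minimality. *)
Lemma finite_prime_torsion (M : lmodType R) (l : nat) : prime l ->
  integral_mod l -> artinian M -> finite_set [set v : M | v *+ l = 0].
Proof.
move=> l_pr R_l art; apply: contrapT => inf_l.
pose P (S : set M) := (forall v, S v -> v *+ l = 0) /\ infinite_set S.
have [|W [subW [Wl infW] minW]] := artinian_minimal (P := P) art.
  exists [set v : M | v *+ l = 0] => //; split=> [|r u v]; first exact: mul0rn.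
  by rewrite /= mulrnDl scalerMnr => -> ->; rewrite scaler0 addr0.
have [x [Wx /eqP x_n0]] : (W `\` [set 0]) !=set0.
  by apply: infinite_setN0; apply: infinite_setD.
have [|U [subU _ Ux maxU]] := max_avoiding_submodule (x := x) (zero_submodule M).
  exact/eqP.
have subUW := setI_submodule subU subW.
have l_gt0 := prime_gt0 l_pr.
have W_cosets : W `<=` [set u + x *+ i | u in U `&` W & i in `I_l].
  move=> y Wy; have [Uy|Uy] := pselect (U y).
    by exists y => //; exists 0%N => //; rewrite addr0.
  have [u Uu [r x_ur]] := maxU y Uy.
  have [i [s r_is]] := R_l r.
  have ry : r *: y = y *+ i.
    rewrite r_is scalerDl scaler_nat mulrC -scalerA scaler_nat Wl //.
    by rewrite scaler0 addr0.
  have [l_i|] := boolP (l %| i)%N.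
    case: Ux; rewrite x_ur ry (mulrn_mod _ (Wl y Wy)) (eqP l_i) mulr0n addr0.
    exact: Uu.
  move=> /(prime_inverse l_pr)[a ai].
  have y_ai : y = y *+ i *+ a.
    rewrite -mulrnA mulnC (mulrn_mod _ (Wl y Wy)) ai.
    by rewrite -(mulrn_mod _ (Wl y Wy)).
  have y_xu : y = (- u) *+ a + x *+ (a %% l).
    rewrite -(mulrn_mod _ (Wl x Wx)) -mulrnDl addrC [in x - u]x_ur addrAC subrr.
    by rewrite add0r ry.
  exists ((- u) *+ a); last by exists (a %% l)%N => //=; rewrite ltn_mod.
  apply: submoduleMn => //; apply: submoduleN => //; split=> //.
  have -> : u = x - r *: y by rewrite x_ur addrK.
  by apply: submoduleB => //; apply: submoduleZ.
have infUW : infinite_set (U `&` W).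
  move=> finU; apply: infW; apply: sub_finite_set W_cosets _.
  by apply: finite_image2.
suff UW : U `&` W = W by apply: Ux; move: Wx; rewrite -UW => -[].
by apply: minW => //; split=> // v [_ /Wl].
Qed.

(** The descending chain of the submodules generated by [c ^+ n *: a] stops. *)
Lemma artinian_power_dvd (M : lmodType R) (c : R) (a : M) : artinian M ->
  exists N t, (c ^+ N * (1 - c * t)) *: a = 0.
Proof.
move=> art; have [n|n|N XN] := art (fun n => line (c ^+ n *: a)).
- exact/submod_closedE/line_submodule.
- by move=> _ [r ->]; exists (r * c); rewrite !scalerA exprS mulrA.
have : line (c ^+ N *: a) (c ^+ N *: a) by exists 1; rewrite scale1r.
rewrite -(XN N.+1) // => -[t e]; exists N, t.
rewrite mulrBr mulr1 scalerBl e !scalerA exprS -scalerBl.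
by rewrite (_ : _ - _ = 0) ?scale0r //; ring.
Qed.

(** The only property of the scalars that the group-theoretic argument uses:
    with [finite_prime_torsion], it makes the [l]-torsion of an artinian module
    finite for each prime [l] that occurs in the order of an element. *)
Definition artinian_torsion : Prop :=
  forall M : lmodType R, artinian M -> forall a : M,
  exists n, [/\ (0 < n)%N, a *+ n = 0 &
    forall l, prime l -> (l %| n)%N -> integral_mod l].

End Torsion.

(** An element killed by [2 ^+ N * (1 - 2 * t)] has finite order, because this
    integer is nonzero. *)
Lemma int_artinian_torsion : artinian_torsion int.
Proof.
move=> M art a; have [N [t Nt]] := artinian_power_dvd 2 a art.
set d := _ * _ in Nt; exists `|d|%N; split.
- rewrite absz_gt0 /d mulf_neq0 ?expf_neq0 //.
  by apply/eqP => ?; lia.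
- have : (`|d|%N%:Z) *: a = 0.
    by rewrite abszE normrEsg -scalerA Nt scaler0.
  by rewrite -natz scaler_nat.
- move=> l l_pr _ x; have l_gt0 := prime_gt0 l_pr.
  exists `|(x %% l)%Z|%N, (x %/ l)%Z.
  rewrite !natz gez0_abs ?modz_ge0 //; last by lia.
  by rewrite addrC mulrC -divz_eq.
Qed.

Section Padic.
Variables (p : nat) (p_pr : prime p).

Let p_gt1 := prime_gt1 p_pr.

Let pn_gt1 n : (1 < p ^ n.+1)%N.
Proof. by rewrite -(exp1n n.+1) ltn_exp2r. Qed.

Let card_pn n : (Zp_trunc (p ^ n.+1)).+2 = (p ^ n.+1)%N.
Proof. exact: Zp_cast (pn_gt1 n). Qed.

Let natZp n k : nat_of_ord (k%:R : 'Z_(p ^ n.+1)) = (k %% p ^ n.+1)%N.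
Proof. by rewrite val_Zp_nat. Qed.

Let eq_natZp n j k : (j = k %[mod p ^ n.+1])%N -> j%:R = k%:R :> 'Z_(p ^ n.+1).
Proof. by move=> jk; apply: val_inj; rewrite /= !natZp. Qed.

Lemma padic_mod_natr k n : (k%:R : padic_int p) n = k%:R.
Proof.
elim: k => [|k IH] //.
by rewrite !mulrS -IH.
Qed.

Lemma padic_modS (x : padic_int p) n :
  nat_of_ord (x n) = (nat_of_ord (x n.+1) %% p ^ n.+1)%N.
Proof. by rewrite -(padic_coherent x n) natZp. Qed.

Lemma padic_mod0 (x : padic_int p) n :
  nat_of_ord (x 0%N) = (nat_of_ord (x n) %% p)%N.
Proof.
elim: n => [|n IH].
  rewrite modn_small // -[X in (_ < X)%N](expn1 p) -[X in (_ < X)%N]card_pn.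
  exact: ltn_ord.
by rewrite IH (padic_modS _ n) modn_dvdm // expnS dvdn_mulr.
Qed.

(** The quotient of [x - x 0] by [p] has as residue modulo [p ^ n.+1] the
    integer quotient by [p] of the representative of [x n.+1]. *)
Lemma padic_integral_mod : integral_mod (padic_int p) p.
Proof.
move=> x.
have y_coh n : ((((x n.+2 : nat) %/ p)%N%:R : 'Z_(p ^ n.+2)) : nat)%:R
    = ((x n.+1 : nat) %/ p)%N%:R :> 'Z_(p ^ n.+1).
  apply: eq_natZp; rewrite natZp (padic_modS x n.+1).
  move: (nat_of_ord (x n.+2)) => k.
  rewrite modn_dvdm; last exact: dvdn_exp2l.
  by rewrite (expnSr p n.+1) -modn_divl modn_mod.
exists (x 0%N), (PadicInt y_coh); apply: padic_ext => n.
rewrite -[RHS]/(((x 0%N : nat)%:R : padic_int p) n +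
  (p%:R : padic_int p) n * ((x n.+1 : nat) %/ p)%N%:R).
rewrite !padic_mod_natr -natrM -natrD -(padic_coherent x n).
apply: eq_natZp; congr (_ %% _)%N.
by rewrite (padic_mod0 x n.+1) addnC mulnC -divn_eq.
Qed.

(** The residues of [1 - p t] are [1] modulo [p], hence units modulo every
    [p ^ n.+1]; by uniqueness of inverses, their inverses are coherent. *)
Lemma padic_inverse (t : padic_int p) : exists v, v * (1 - p%:R * t) = 1.
Proof.
set u := 1 - _.
have u0 : u 0%N = 1.
  rewrite -[u 0%N]/(1 - (p%:R : padic_int p) 0%N * t 0%N) padic_mod_natr.
  rewrite (_ : p%:R = 0) ?mul0r ?subr0 //; apply: val_inj.
  by rewrite /= natZp expn1 modnn.
clearbody u.
have uU n : u n \is a GRing.unit.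
  rewrite -[u n]natr_Zp unitZpE // coprime_sym coprime_pexpr // coprime_sym.
  rewrite prime_coprime // /dvdn -padic_mod0 u0.
  by [].
have v_coh n : (nat_of_ord (u n.+1)^-1)%:R = (u n)^-1.
  apply: (mulIr (uU n)); rewrite (mulVr (uU n)).
  have := congr1 (@nat_of_ord _) (mulVr (uU n.+1)).
  move: (u n.+1)^-1 (padic_coherent u n) => w <-.
  have modE k : (k %% (Zp_trunc (p ^ n.+2)).+2 = k %% p ^ n.+2)%N.
    by rewrite card_pn.
  rewrite /= !modE => wu.
  transitivity ((w * u n.+1)%N%:R : 'Z_(p ^ n.+1)); first by rewrite natrM.
  rewrite -[1]/(1%:R); apply: eq_natZp.
  by rewrite -(modn_dvdm _ (dvdn_exp2l p (leqnSn n.+1))) wu modn_dvdm ?dvdn_exp2l.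
exists (PadicInt v_coh); apply: padic_ext => n.
exact: (mulVr (uU n)).
Qed.

(** Since [1 - p t] is invertible, an element killed by [p ^ N * (1 - p t)] is
    killed by [p ^ N], so [p] is the only prime to consider. *)
Lemma padic_artinian_torsion : artinian_torsion (padic_int p).
Proof.
move=> M art a; have [N [t Nt]] := artinian_power_dvd p%:R a art.
have [v vt] := padic_inverse t.
exists (p ^ N)%N; split; first by rewrite expn_gt0 prime_gt0.
  have -> : a *+ p ^ N = v *: ((p%:R ^+ N * (1 - p%:R * t)) *: a).
    by rewrite scalerA mulrCA vt mulr1 -natrX scaler_nat.
  by rewrite Nt scaler0.
move=> l l_pr; rewrite Euclid_dvdX // => /andP[l_p _].
move: l_p; rewrite dvdn_prime2 // => /eqP ->; exact: padic_integral_mod.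
Qed.

End Padic.

(** * Infinite hollow modules over the integers *)

(** Hollow in the usual sense of module theory, except that the zero module is
    accepted. *)
Definition hollow (R : nzRingType) (M : lmodType R) : Prop :=
  forall S T : set M, is_submodule S -> is_submodule T ->
  sum_set S T = [set: M] -> S = [set: M] \/ T = [set: M].

Lemma coprimez_prime (q : nat) (z : int) :
  prime q -> ~~ (q %| z)%Z -> coprimez q z.
Proof. by move=> q_pr; rewrite dvdzE /coprimez /gcdz /= -prime_coprime. Qed.

Section IntModules.
Variable V : lmodType int.
Implicit Types (S T U : set V) (u v x y : V).

Lemma scalez_nat (n : nat) v : n%:Z *: v = v *+ n.
Proof. by rewrite -natz scaler_nat. Qed.

Lemma submodule_coprime S v (m n : int) : is_submodule S -> coprimez m n ->
  S (m *: v) -> S (n *: v) -> S v.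
Proof.
move=> subS /coprimezP[[a b] /= ab] Sm Sn.
rewrite -(scale1r v) -ab scalerDl -!scalerA.
by apply: submoduleD => //; apply: submoduleZ.
Qed.

(** Take [M] maximal among the submodules containing [q x] and avoiding [x].
    Every nonzero submodule of [V / M] contains the class of [x], which has
    order [q], so [V / M] is a [q]-group. *)
Lemma line_notin_prime_quotient x q : prime q -> ~ line (q%:Z *: x) x ->
  exists M, [/\ is_submodule M, ~ M x &
    forall v, exists k, M ((q ^ k)%N%:Z *: v)].
Proof.
move=> q_pr xq.
have [M [subM qM Mx maxM]] :=
  max_avoiding_submodule (line_submodule (q%:Z *: x)) xq.
exists M; split=> // v.
have Mqx : M (q%:Z *: x) by apply: qM; exists 1; rewrite scale1r.
have [Mv|Mv] := pselect (M v); first by exists 0%N; rewrite scale1r.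
have [m Mm [r x_mr]] := maxM v Mv.
have Mqr : M ((q%:Z * r) *: v).
  have -> : (q%:Z * r) *: v = q%:Z *: x - q%:Z *: m.
    by rewrite -scalerBr x_mr addrAC subrr add0r scalerA.
  by apply: submoduleB => //; apply: submoduleZ.
have r_n0 : r != 0.
  by apply: contra_notN Mx => /eqP r0; rewrite x_mr r0 scale0r addr0.
have n_gt0 : (0 < `|(q%:Z * r)%R|)%N.
  by rewrite absz_gt0 mulf_neq0 // -lt0n prime_gt0.
have Mn : M (`|(q%:Z * r)%R|%N%:Z *: v).
  by rewrite abszE normrEsg -scalerA; apply: submoduleZ.
move: {Mqr} `|_|%N n_gt0 Mn => n n_gt0 Mn.
have [k [n' qn' n_eq]] :
    exists k, exists2 n', ~~ (q %| n')%N & n = (n' * q ^ k)%N.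
  exists (logn q n), (n`_q^')%N; last by rewrite mulnC -p_part partnC.
  rewrite -prime_coprime // coprime_sym.
  by rewrite (@p'nat_coprime q) // ?part_pnat // pnat_id.
(* otherwise x is a multiple of v' = q^k v modulo M, so both q and n' kill x
   modulo M *)
exists k; apply: contrapT => /maxM[m' Mm' [s x_ms]].
apply: Mx; apply: (@submodule_coprime _ _ q%:Z n'%:Z) => //.
  exact: coprimez_prime.
rewrite x_ms scalerDr; apply: submoduleD => //; first exact: submoduleZ.
rewrite scalerA mulrC -scalerA; apply: submoduleZ => //.
by rewrite scalerA -PoszM -n_eq.
Qed.

Hypothesis V_hollow : hollow V.

(** A sum of two submodules with quotients a [q]-group and an [r]-group is the
    whole module when [q != r]. *)
Lemma hollow_prime_unique x y q r : prime q -> prime r ->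
  ~ line (q%:Z *: x) x -> ~ line (r%:Z *: y) y -> q = r.
Proof.
move=> q_pr r_pr xq yr; apply: contrapT => /eqP q_r.
have [M [subM Mx Mq]] := line_notin_prime_quotient q_pr xq.
have [N [subN Ny Nr]] := line_notin_prime_quotient r_pr yr.
have [||] := V_hollow subM subN; last 2 first.
- by move=> MT; apply: Mx; rewrite MT.
- by move=> NT; apply: Ny; rewrite NT.
apply/seteqP; split=> // v _.
have [[k Mk] [l Nl]] := (Mq v, Nr v).
have subMN := sum_submodule subM subN.
apply: (@submodule_coprime _ _ (q ^ k)%N%:Z (r ^ l)%N%:Z) => //.
- rewrite /coprimez /gcdz /= -/(coprime _ _).
  by apply: coprimeXl; apply: coprimeXr; rewrite prime_coprime ?dvdn_prime2.
- exact: sum_setl.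
- by exists 0; [exact: submodule0|exists ((r ^ l)%N%:Z *: v); rewrite ?add0r].
Qed.

Lemma finite_order_ex v q : prime q -> line (q%:Z *: v) v ->
  exists2 n, (0 < n)%N & v *+ n = 0.
Proof.
move=> q_pr [z v_z]; exists `|(1 - z * q%:Z)%R|%N.
  rewrite absz_gt0 subr_eq0; apply/eqP => e1.
  have := congr1 absz e1; rewrite abszM /= => /esym/eqP; rewrite muln_eq1.
  by case/andP => _ /eqP q1; rewrite q1 in q_pr.
have z0 : (1 - z * q%:Z) *: v = 0 by rewrite scalerBl scale1r -scalerA -v_z subrr.
by rewrite -scaler_nat natz abszE normrEsg -scalerA z0 scaler0.
Qed.

(** Let [m] be the order of [v]: a prime [r] divides [m] exactly when [v] is
    not a multiple of [r v]. Both claims follow: [m != 1] has a prime divisor,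
    and [m] is a power of [q] if it has no other one. *)
Lemma order_prime_notin v n : v *+ n = 0 -> v != 0 -> (0 < n)%N ->
  (exists2 q, prime q & ~ line (q%:Z *: v) v) /\
  (forall q, prime q -> (forall r, prime r -> r != q -> line (r%:Z *: v) v) ->
    exists k, v *+ (q ^ k) = 0).
Proof.
move=> vn v_n0 n_gt0.
have ex_m : exists m, (0 < m)%N && (v *+ m == 0).
  by exists n; rewrite n_gt0 vn eqxx.
case: (ex_minnP ex_m) => m /andP[m_gt0 /eqP vm] min_m.
have divm r : prime r -> (r %| m)%N -> ~ line (r%:Z *: v) v.
  move=> r_pr /dvdnP[d m_dr] [z v_z].
  have d_gt0 : (0 < d)%N by case: d m_dr m_gt0 => // ->.
  have /min_m : (0 < d)%N && (v *+ d == 0).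
    by rewrite d_gt0 v_z scalez_nat scalerMnr -mulrnA mulnC -m_dr vm scaler0 eqxx.
  by rewrite m_dr leqNgt -{1}(muln1 d) ltn_pmul2l // prime_gt1.
split.
  have m_gt1 : (1 < m)%N.
    by case: m m_gt0 vm {min_m divm} => [|[|//]] // _ /eqP; rewrite (negPf v_n0).
  exists (pdiv m); first exact: pdiv_prime.
  by apply: divm; [apply: pdiv_prime|apply: pdiv_dvd].
move=> q q_pr vr.
exists (logn q m).
have : q.-nat m.
  apply/pnatP => // r r_pr r_m; rewrite inE; apply: contrapT => /negP r_q.
  exact: divm r_pr r_m (vr r r_pr r_q).
by move=> /p_natP[k mk]; move: vm; rewrite mk pfactorK.
Qed.

(** Exactly one prime [q] can fail to satisfy [x \in line (q x)] for some [x],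
    by [hollow_prime_unique]. Any other prime shows that each element has
    finite order, and then that this order is a power of [q]. *)
Lemma hollow_primary : infinite_set [set: V] ->
  exists2 q, prime q & forall v, exists k, v *+ (q ^ k) = 0.
Proof.
move=> infV.
have [x [_ /eqP x_n0]] : ([set: V] `\` [set 0]) !=set0.
  by apply: infinite_setN0; apply: infinite_setD.
have [q q_pr xq] : exists2 q, prime q & ~ line (q%:Z *: x) x.
  have [x2|] := pselect (line (2%:Z *: x) x); last by exists 2%N.
  have [n n_gt0 xn] := finite_order_ex (isT : prime 2) x2.
  by have [] := order_prime_notin xn x_n0 n_gt0.
exists q => // v.
have vr r : prime r -> r != q -> line (r%:Z *: v) v.
  move=> r_pr r_q; apply: contrapT => /(hollow_prime_unique r_pr q_pr) /(_ xq).
  exact/eqP.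
have [r r_pr r_q] : exists2 r, prime r & r != q.
  by have [->|] := eqVneq q 2%N; [exists 3%N|exists 2%N => //; rewrite eq_sym].
have [n n_gt0 vn] := finite_order_ex r_pr (vr r r_pr r_q).
have [->|v_n0] := eqVneq v 0; first by exists 0%N; rewrite mul0rn.
by have [_] := order_prime_notin vn v_n0 n_gt0; apply.
Qed.

(** If [x] is not in [q V], a maximal submodule [M] containing [q V] and avoiding
    [x] satisfies [V = M + line x], since [V / M] is killed by [q]. As [V] is
    hollow, it is the finite module generated by [x]. *)
Lemma hollow_divisible q : infinite_set [set: V] -> prime q ->
  (forall v, exists k, v *+ (q ^ k) = 0) -> forall v, exists u, v = u *+ q.
Proof.
move=> infV q_pr Vq x; apply: contrapT => xq.
pose qV : set V := [set v | exists u, v = u *+ q].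
have subqV : is_submodule qV.
  split=> [|r _ _ [u ->] [v ->]]; first by exists 0; rewrite mul0rn.
  by exists (r *: u + v); rewrite mulrnDl scalerMnr.
have [M [subM qM Mx maxM]] := max_avoiding_submodule subqV xq.
have [||] := V_hollow subM (line_submodule x).
- apply/seteqP; split=> // v _.
  have [Mv|Mv] := pselect (M v); first exact: sum_setl (line_submodule x) _ Mv.
  have [m Mm [r x_mr]] := maxM v Mv.
  have subL := sum_submodule subM (line_submodule x).
  have Mqv : M (q%:Z *: v) by apply: qM; exists v; rewrite scalez_nat.
  apply: (@submodule_coprime _ _ q%:Z r) => //.
  + apply: coprimez_prime => //; apply/negP => /dvdzP[s r_s].
    apply: Mx; rewrite x_mr r_s; apply: submoduleD => //.
    by rewrite -scalerA; apply: submoduleZ.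
  + exact: sum_setl (line_submodule x) _ Mqv.
  + have -> : r *: v = - m + x by rewrite x_mr addKr.
    exists (- m); first exact: submoduleN.
    by exists x => //; exists 1; rewrite scale1r.
- by move=> MT; apply: Mx; rewrite MT.
move=> xT; apply: infV; have [k xk] := Vq x.
have qk_gt0 : (0 < q ^ k)%N by rewrite expn_gt0 prime_gt0.
suff: [set: V] `<=` [set x *+ i | i in `I_(q ^ k)].
  by move=> /sub_finite_set; apply; apply: finite_image.
rewrite -xT => _ [r ->]; exists `|(r %% (q ^ k)%N)%Z|%N => /=.
  by have := ltz_pmod r (d := (q ^ k)%N) ; lia.
rewrite [in RHS](divz_eq r (q ^ k)%N) scalerDl -scalerA.
rewrite scalez_nat xk scaler0 add0r.
by rewrite -scalez_nat gez0_abs // modz_ge0; lia.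
Qed.

End IntModules.

(** * Quasi-cyclic groups *)

(** A sequence [e] in which [e 0] has order [q] and each [e n.+1] is a [q]-th
    root of the preceding term. The element [e n] corresponds to the class of
    [1 / q ^ n.+1] in the rationals modulo the integers. *)
Section PruferTower.
Variables (V : lmodType int) (q : nat) (e : nat -> V).
Hypotheses (q_pr : prime q) (e0_neq0 : e 0%N != 0) (e0_q : e 0%N *+ q = 0).
Hypothesis eS : forall n, e n.+1 *+ q = e n.

Lemma tower_raise n m : e (n + m)%N *+ q ^ m = e n.
Proof.
elim: m => [|m IH]; first by rewrite addn0.
by rewrite addnS expnS mulrnA eS.
Qed.

Lemma tower_order n (z : int) : z *: e n = 0 <-> ((q ^ n.+1)%N %| z)%Z.
Proof.
have annul k (w : int) : ((q ^ k.+1)%N %| w)%Z -> w *: e k = 0.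
  move=> /dvdzP[d ->]; rewrite -scalerA scalez_nat expnS mulnC mulrnA.
  by rewrite -{1}(add0n k) tower_raise e0_q scaler0.
have ann0 (w : int) : w *: e 0%N = 0 -> (q %| w)%Z.
  move=> w0; apply: contraT => /(coprimez_prime q_pr) co_qw.
  case/eqP: e0_neq0.
  apply: (submodule_coprime (zero_submodule V) co_qw) => //.
  by rewrite /= scalez_nat.
split; last exact: annul.
elim: n z => [|n IH] z zn; first by rewrite expn1; apply: ann0.
have /IH/dvdzP[w zw] : z *: e n = 0.
  by rewrite -eS -scalerMnr zn mul0rn.
have qw : (q %| w)%Z.
  apply: ann0; rewrite -(tower_raise 0 n.+1) add0n -scalez_nat scalerA -zw.
  exact: zn.
by rewrite zw (expnS q n.+1) PoszM; apply: dvdz_mul.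
Qed.

(** The graph of the isomorphism with the quasi-cyclic group, before reduction
    of the rational [r] modulo the integers. A relation makes independence of
    the chosen [n] and [z] a consequence of [tower_fracB] and
    [tower_frac_int]. *)
Definition tower_frac (v : V) (r : rat) : Prop :=
  exists n (z : int), v = z *: e n /\ r = z%:~R / (q ^ n.+1)%:R.

Let qX_neq0 n : (q ^ n)%:R != 0 :> rat.
Proof. by rewrite pnatr_eq0 -lt0n expn_gt0 prime_gt0. Qed.

Lemma tower_fracB v w r s :
  tower_frac v r -> tower_frac w s -> tower_frac (v - w) (r - s).
Proof.
move=> [n [z [-> ->]]] [m [y [-> ->]]].
exists (n + m)%N, (z * (q ^ m)%N%:Z - y * (q ^ n)%N%:Z); split.
  rewrite scalerBl -!scalerA !scalez_nat tower_raise.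
  by rewrite [(n + m)%N]addnC tower_raise.
rewrite intrB !intrM -!pmulrn -addSn expnD natrM.
have -> : (q ^ n.+1)%:R = q%:R * (q ^ n)%:R :> rat by rewrite expnS natrM.
have -> : (q ^ m.+1)%:R = q%:R * (q ^ m)%:R :> rat by rewrite expnS natrM.
have q0 : q%:R != 0 :> rat by rewrite -(expn1 q).
by field; rewrite q0 !qX_neq0.
Qed.

Lemma tower_frac_int v r : tower_frac v r -> (r \is a Num.int <-> v = 0).
Proof.
move=> [n [z [-> ->]]]; rewrite tower_order; split=> [/intrP[k zk]|/dvdzP[k ->]].
  apply/dvdzP; exists k; apply: (@intr_inj rat).
  by rewrite intrM -zk -pmulrn divfK.
by rewrite intrM -pmulrn mulfK ?intr_int.
Qed.

Local Notation pi := (\pi_rat_mod_int)%qT.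

Lemma pi_rat r s : pi r = pi s <-> r - s \is a Num.int.
Proof.
rewrite -[_ \is a _]/(_ \in rat_int) Quotient.idealrBE.
by split=> [->|/eqP].
Qed.

Lemma tower_frac_primary v r : tower_frac v r -> pi r \in primary_pred q.
Proof.
move=> [n [z [_ ->]]]; apply/asboolP; exists n.+1.
rewrite -raddfMn; have -> : 0 = pi 0 by rewrite raddf0.
by apply/pi_rat; rewrite subr0 -(mulr_natr (_ / _)) divfK ?intr_int.
Qed.

Lemma tower_iso : (forall v, exists n z, v = z *: e n) ->
  exists f : V -> quasi_cyclic q, {morph f : x y / x + y} /\ bijective f.
Proof.
move=> Ve; have [v|r r_frac] := @choice _ _ tower_frac.
  have [n [z vz]] := Ve v.
  by exists (z%:~R / (q ^ n.+1)%:R), n, z.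
pose f v : quasi_cyclic q := exist _ (pi (r v)) (tower_frac_primary (r_frac v)).
have fE v s : tower_frac v s -> val (f v) = pi s.
  move=> vs; apply/pi_rat/(tower_frac_int (v := 0)) => //.
  by rewrite -(subrr v); apply: tower_fracB.
have f_inj : injective f.
  move=> v w /(congr1 val) vw.
  have {}vw : r v - r w \is a Num.int by apply/pi_rat.
  have [/(_ vw) + _] := tower_frac_int (tower_fracB (r_frac v) (r_frac w)).
  by move/eqP; rewrite subr_eq0 => /eqP.
have f_surj u : exists v, f v = u.
  case: u => u u_prim; have /asboolP[n un] := u_prim.
  have : pi (repr u *+ q ^ n) = pi 0.
    transitivity (pi (repr u) *+ q ^ n); first exact: raddfMn.
    by rewrite reprK un raddf0.
  move=> /pi_rat; rewrite subr0 => /intrP[z uz].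
  exists ((z * q%:Z) *: e n); apply: val_inj; rewrite (fE _ (repr u)) ?reprK //=.
  exists n, (z * q%:Z); split=> //.
  apply: (mulIf (qX_neq0 n.+1)); rewrite divfK // intrM -uz -pmulrn.
  by rewrite -[repr u *+ _]mulr_natr expnSr natrM mulrA.
exists f; split=> [v w|].
  apply: val_inj; rewrite /= -[RHS](raddfD pi); apply/pi_rat.
  apply/(tower_frac_int (v := 0)) => //; rewrite opprD addrA.
  have -> : 0 = v + w - v - w by rewrite [v + w]addrC addrK subrr.
  by do 2?apply: tower_fracB.
have [g gK] := choice f_surj.
by exists g => // v; apply: f_inj.
Qed.

End PruferTower.

(** Divisibility gives a quasi-cyclic subgroup [P] above an element [x] of order
    [q]. If [K] is maximal avoiding [x], then [K + P] is everything: if [q v]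
    is in [K + P], divisibility of [P] gives [w], congruent to [v] modulo [P],
    with [q w] in [K]; and if [w] is not in [K], then [x] is a multiple [s w]
    modulo [K] with [s] prime to [q], so [w] is in [K + line x]. Since [K]
    avoids [x] and the module is hollow, [P] is everything. *)
Theorem hollow_Prufer (V : lmodType int) : hollow V -> infinite_set [set: V] ->
  exists2 q : nat, prime q & exists f : V -> quasi_cyclic q,
    {morph f : x y / x + y} /\ bijective f.
Proof.
move=> V_hollow infV; have [q q_pr Vq] := hollow_primary V_hollow infV.
exists q => //.
have [d dE] := choice (hollow_divisible V_hollow infV q_pr Vq).
have [x x_n0 xq] : exists2 x : V, x != 0 & x *+ q = 0.
  have [y [_ /eqP y_n0]] : ([set: V] `\` [set 0]) !=set0.
    by apply: infinite_setN0; apply: infinite_setD.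
  have [k] := Vq y; elim: k y y_n0 => [|k IH] y y_n0.
    by rewrite mulr1n => y0; rewrite y0 eqxx in y_n0.
  rewrite expnS mulrnA; have [yq|yq] := eqVneq (y *+ q) 0; last exact: IH.
  by exists y.
pose e n := iter n d x.
have eS n : e n.+1 *+ q = e n by rewrite -dE.
apply: (tower_iso (e := e)) => //.
pose P : set V := [set v | exists n z, v = z *: e n].
suff PT : P = setT by move=> v; rewrite -[_ _]/(P v) PT.
have subP : is_submodule P.
  split=> [|r _ _ [n [z ->]] [m [y ->]]].
    by exists 0%N, 0; rewrite scale0r.
  exists (n + m)%N, (r * z * (q ^ m)%N%:Z + y * (q ^ n)%N%:Z).
  rewrite scalerDl -!scalerA !scalez_nat tower_raise //.
  by rewrite [(n + m)%N]addnC tower_raise.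
have [|K [subK _ Kx maxK]] := max_avoiding_submodule (x := x) (zero_submodule V).
  exact/eqP.
have subKP := sum_submodule subK subP.
have Px : P x by exists 0%N, 1; rewrite scale1r.
have K_sumr v : P v -> sum_set K P v.
  by move=> Pv; exists 0; [exact: submodule0|exists v; rewrite ?add0r].
have [||//] := V_hollow _ _ subK subP; last first.
  by move=> KT; case: Kx; rewrite KT.
apply/seteqP; split=> // v _; have [k] := Vq v.
elim: k v => [|k IH] v; first by rewrite mulr1n => ->; apply: submodule0.
rewrite expnS mulrnA => /IH[a Ka [b [n [z b_z]] vq]].
pose w := v - z *: e n.+1.
have Kw : K (q%:Z *: w).
  by rewrite scalez_nat mulrnBl scalerMnr eS -b_z vq addrK.
suff KPw : sum_set K P w.
  rewrite -[v](subrK (z *: e n.+1)); apply: submoduleD => //.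
  by apply: K_sumr; exists n.+1, z.
have [Kw1|/maxK[c Kc [s x_cs]]] := pselect (K w); first exact: sum_setl.
apply: (@submodule_coprime _ _ _ q%:Z s subKP).
- apply: coprimez_prime => //; apply/negP => /dvdzP[t st].
  apply: Kx; rewrite x_cs st -scalerA; apply: submoduleD => //.
  exact: submoduleZ.
- exact: sum_setl.
- have -> : s *: w = - c + x by rewrite x_cs addKr.
  by exists (- c); [exact: submoduleN|exists x].
Qed.

(** * Groups in which two proper subgroups never generate *)

Section Subgroups.
Variable G : groupType.
Implicit Types (H K X : set G) (x y g h : G).

Lemma is_subgroupE H :
  is_subgroup H <-> H 1%g /\ forall x y, H x -> H y -> H (x * y^-1)%g.
Proof.
split=> -[H1 HD]; split=> [|x y Hx Hy].
- by rewrite -in_setE.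
- by rewrite -in_setE; apply: HD; rewrite in_setE.
- by rewrite in_setE.
- by move: Hx Hy; rewrite !in_setE; apply: HD.
Qed.

Definition gen X : set G := smallest (@is_subgroup G) X.

Lemma gen_subgroup X : is_subgroup (gen X).
Proof.
apply/is_subgroupE; split=> [H [/is_subgroupE[]] //|x y Xx Xy H subH].
have /is_subgroupE[_ HD] := subH.1.
by apply: HD; [apply: Xx|apply: Xy].
Qed.

Lemma subset_gen X : X `<=` gen X.
Proof. exact: sub_gen_smallest. Qed.

Lemma gen_subset X H : is_subgroup H -> X `<=` H -> gen X `<=` H.
Proof. by move=> subH XH; apply: smallest_sub. Qed.

Lemma subgroupM H x y : is_subgroup H -> H x -> H y -> H (x * y)%g.
Proof.
move=> /group_closedM HM Hx Hy.
by rewrite -in_setE; apply: HM; rewrite in_setE.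
Qed.

Lemma centraliser_subgroup x : is_subgroup [set y | commute x y].
Proof.
apply/is_subgroupE; split=> [|y z xy xz] /=; first exact: commute1.
by apply: commuteM => //; apply: commuteV.
Qed.

(** Centralisers are subgroups, so one containing a generator is everything. *)
Lemma cyclic_commute x : gen [set x] = [set: G] -> forall y z : G, commute y z.
Proof.
move=> xT.
have cent u : commute u x -> forall y, commute u y.
  move=> ux y; have : gen [set x] y by rewrite xT.
  by apply: gen_subset; [exact: centraliser_subgroup|move=> _ ->].
by move=> y z; apply: (cent); apply/commute_sym/cent.
Qed.

(** The group analogue of [hollow]. *)
Definition join_proper : Prop := forall H K,
  proper_subgroup H -> proper_subgroup K -> proper_subgroup (gen (H `|` K)).

Hypothesis G_join : join_proper.
Hypothesis G_noncyclic : forall x, gen [set x] <> [set: G].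

Lemma gen_seq_proper H (s : seq G) : proper_subgroup H ->
  exists2 K, proper_subgroup K & H `<=` K /\ [set` s] `<=` K.
Proof.
move=> properH; elim: s => [|x s [K properK [HK sK]]].
  by exists H => //; split.
exists (gen (K `|` gen [set x])).
  by apply: G_join => //; split; [exact: gen_subgroup|].
split=> [h /HK Kh|y]; first by apply: subset_gen; left.
rewrite /= in_cons => /orP[/eqP ->|/sK Ky]; apply: subset_gen; last by left.
by right; apply: subset_gen.
Qed.

(** The fibres of [f] lie in cosets of [H], so [H] and finitely many elements
    generate the group; but adjoining finitely many elements to a proper
    subgroup keeps it proper when no cyclic subgroup is the whole group. *)
Lemma finite_index_full H (T : Type) (f : G -> T) : is_subgroup H ->
  finite_set (range f) -> (forall g h, f g = f h -> H (g * h^-1)%g) ->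
  H = [set: G].
Proof.
move=> subH fin_f fH; apply: contrapT => properH.
elim/Pchoice : T f fin_f fH => T f fin_f fH.
have [s f_s] := (finite_seqP _).1 fin_f.
have [r rE] : {r : T -> G & forall t, range f t -> f (r t) = t}.
  apply: (@choice _ _ (fun t g => range f t -> f g = t)) => t.
  have [[g _ gt]|nt] := pselect (range f t); first by exists g.
  by exists 1%g => /nt.
have [K [subK KT] [HK sK]] := gen_seq_proper (map r s) (conj subH properH).
apply: KT; apply/seteqP; split=> // g _.
have fg : range f (f g) by exists g.
rewrite -[g](mulgVK (r (f g))); apply: subgroupM => //.
  by apply/HK/fH; rewrite rE.
by apply: sK => /=; apply: map_f; move: fg; rewrite f_s.
Qed.

End Subgroups.

(** * The action of the group *)

Section Action.
Variables (R : comNzRingType) (G : groupType) (A : grmodType R G).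
Implicit Types (a b : A) (g h : G) (H K : set G).

Lemma gractD a b g : gract (a + b) g = gract a g + gract b g.
Proof. by have := gract_linear g 1 a b; rewrite !scale1r. Qed.

Lemma gract0 g : gract (0 : A) g = 0.
Proof. by apply: (addrI (gract 0 g)); rewrite -gractD !addr0. Qed.

Lemma gractB a b g : gract (a - b) g = gract a g - gract b g.
Proof. by apply: (addIr (gract b g)); rewrite -gractD !subrK. Qed.

Lemma gractMn a n g : gract (a *+ n) g = gract a g *+ n.
Proof. by elim: n => [|n IH]; rewrite ?gract0 // !mulrS gractD IH. Qed.

Lemma gractK a g : gract (gract a g) g^-1%g = a.
Proof. by rewrite -gractM mulgV gract1. Qed.

Lemma fixer_subgroup a : is_subgroup [set g | gract a g = a].
Proof.
apply/is_subgroupE; split=> [|g h /= ag ah]; first exact: gract1.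
by rewrite gractM ag -{1}ah gractK.
Qed.

Lemma cent_modE H a : (a \in cent_mod A H) = `[< forall h, H h -> gract a h = a >].
Proof. by []. Qed.

Lemma cent_mod_submodule H : is_submodule [set a | a \in cent_mod A H].
Proof.
split=> [|r u v]; first exact: rpred0.
by move=> Hu Hv; apply: rpredD => //; apply: rpredZ.
Qed.

Lemma cent_mod_gen H K :
  [set a | a \in cent_mod A (gen (H `|` K))] =
  [set a | a \in cent_mod A H] `&` [set a | a \in cent_mod A K].
Proof.
apply/seteqP; split=> a /=; rewrite !cent_modE.
  by move=> /asboolP aHK; split; apply/asboolP => h ?; apply: aHK;
    apply: subset_gen; [left|right].
move=> [/asboolP aH /asboolP aK]; apply/asboolP => h.
apply: (gen_subset (fixer_subgroup a)) => g [Hg|Kg]; [exact: aH|exact: aK].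
Qed.

(** The fixed points of the join of [H] and [K] are the common fixed points, and
    the quotient by an intersection inherits the chain condition. *)
Lemma artinian_join_proper :
  ~ artinian (quot_mod (cent_mod A [set: G])) ->
  (forall H, proper_subgroup H -> artinian (quot_mod (cent_mod A H))) ->
  join_proper G.
Proof.
move=> AG AH H K properH properK; split; first exact: gen_subgroup.
move=> HKT; apply: AG; apply/artinian_quotP; rewrite -HKT cent_mod_gen.
by apply: artinian_above_setI; try exact: cent_mod_submodule;
  apply/artinian_quotP; apply: AH.
Qed.

Section TrivialAction.
Variable H : set G.
Hypothesis H_normal : forall h g, H h -> H (g * h * g^-1)%g.
Local Notation C := (cent_mod A H).
Local Notation pi := (\pi_(quot_mod C))%qT.

Lemma cent_mod_stable a g : a \in C -> gract a g \in C.
Proof.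
rewrite !cent_modE => /asboolP aH; apply/asboolP => h Hh.
rewrite -gractM -[(g * h)%g](mulgVK g) gractM aH //.
exact: H_normal.
Qed.

Lemma pi_gract a b g : pi a = pi b -> pi (gract a g) = pi (gract b g).
Proof. by move=> /pi_eq ab; apply/pi_eq; rewrite -gractB cent_mod_stable. Qed.

Lemma pi_fixer_subgroup a : is_subgroup [set g | pi (gract a g) = pi a].
Proof.
apply/is_subgroupE; split=> [|g h /= ag ah]; first by rewrite /= gract1.
by rewrite gractM (pi_gract _ ag) -(pi_gract _ ah) gractK.
Qed.

(** By induction on an exponent [n] of [pi a]. Let [l] be a prime divisor of
    [n]. By induction [pi (a *+ l)] is fixed, so the orbit of [pi a] lies in
    its translate by the finite [l]-torsion. The stabiliser of [pi a] has
    therefore finite index, so it is the whole group. *)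
Lemma artinian_trivial_action : join_proper G ->
  (forall x : G, gen [set x] <> [set: G]) -> artinian_torsion R ->
  artinian (quot_mod C) -> forall a g, pi (gract a g) = pi a.
Proof.
move=> G_join G_nc R_tors artC a.
have [n [n_gt0 an n_int]] := R_tors _ artC (pi a).
have [k] := ubnP n; elim: k => // k IH in n a n_gt0 an n_int * => n_k g.
have [n1|n_gt1] : (n = 1 \/ 1 < n)%N by lia.
  move: an; rewrite n1 mulr1n => a0.
  rewrite a0; apply/pi_eq0/cent_mod_stable; exact/pi_eq0.
pose l := pdiv n; pose m := (n %/ l)%N.
have l_pr : prime l by apply: pdiv_prime.
have n_ml : n = (m * l)%N by rewrite divnK ?pdiv_dvd.
have piMn b i : pi (b *+ i) = pi b *+ i by exact: raddfMn.
have al g' : pi (gract (a *+ l) g') = pi (a *+ l).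
  apply: (IH m).
  - by rewrite divn_gt0 ?pdiv_gt0 // dvdn_leq ?pdiv_dvd.
  - by rewrite piMn -mulrnA mulnC -n_ml.
  - by move=> p p_pr p_m; apply: n_int => //; rewrite n_ml dvdn_mulr.
  - by apply: (@leq_trans n) n_k; apply: ltn_Pdiv => //; exact: prime_gt1.
suff : [set h | pi (gract a h) = pi a] = [set: G].
  by move=> aT; rewrite -[_ = _]/([set h | pi (gract a h) = pi a] g) aT.
apply: (finite_index_full G_join G_nc (f := fun h => pi (gract a h))).
- exact: pi_fixer_subgroup.
- have l_int : integral_mod R l by apply: n_int; rewrite ?pdiv_dvd.
  have := finite_image (fun u => u + pi a) (finite_prime_torsion l_pr l_int artC).
  apply: sub_finite_set => _ [h _ <-].
  exists (pi (gract a h) - pi a); last by rewrite subrK.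
  by rewrite /= mulrnBl -!piMn -gractMn al subrr.
- by move=> h h' hh' /=; rewrite gractM (pi_gract _ hh') gractK.
Qed.

End TrivialAction.

(** A subgroup containing all the commutators is normal. *)
Lemma derived_gen_normal x h g :
  gen (derived_subgroup G `|` gen [set x]) h ->
  gen (derived_subgroup G `|` gen [set x]) (g * h * g^-1)%g.
Proof.
move=> Hh; have -> : (g * h * g^-1 = [~ g^-1, h^-1] * h)%g.
  by rewrite commgEl conjgE !invgK !mulgA mulgVK.
apply: (subgroupM _ _ Hh); first exact: gen_subgroup.
by apply: subset_gen; left; apply: subset_gen; exists g^-1%g, h^-1%g.
Qed.

(** For each [x], the subgroup generated by [x] and the derived subgroup is
    normal and proper, so the group acts trivially modulo its fixed points. In
    particular [x] fixes [a g - a] for all [a] and [g]. Hence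
    [a g x = a g + a x - a], which is symmetric in [g] and [x], and
    faithfulness gives commutativity. *)
Lemma artinian_commute : join_proper G ->
  [set: G] <> derived_subgroup G ->
  (forall x : G, gen [set x] <> [set: G]) -> artinian_torsion R ->
  cent_group A = [set 1%g] ->
  (forall H, proper_subgroup H -> artinian (quot_mod (cent_mod A H))) ->
  forall x y : G, commute x y.
Proof.
move=> G_join G_der G_nc R_tors A_faithful AH.
have act_sub a g x : gract (gract a g) x - gract a x = gract a g - a.
  pose H := gen (derived_subgroup G `|` gen [set x]).
  have properH : proper_subgroup H.
    apply: G_join; split; try exact: gen_subgroup; last exact: G_nc.
    exact/nesym.
  have /pi_eq := artinian_trivial_action (@derived_gen_normal x) G_join G_nc R_tors
    (AH _ properH) a g.
  rewrite cent_modE -gractB => /asboolP; apply.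
  by apply: subset_gen; right; apply: subset_gen.
move=> x y.
have : cent_group A ((x * y) * (y * x)^-1)%g.
  move=> a; rewrite gractM.
  have -> : gract a (x * y)%g = gract a (y * x)%g.
    rewrite !gractM.
    rewrite -[LHS](subrK (gract a y)) act_sub -[RHS](subrK (gract a x)) act_sub.
    by rewrite addrAC [RHS]addrAC [gract a y + _]addrC.
  exact: gractK.
by rewrite A_faithful => /divg1_eq.
Qed.

End Action.

(** * Commutative groups written additively *)

(** The commutativity proof is a parameter so that the additive structure below
    can be attached to the type. *)
Definition additive_of (G : groupType)
  (_ : forall x y : G, commute x y) : Type := G.

Section Additive.
Variables (G : groupType) (G_comm : forall x y : G, commute x y).
Local Notation Ga := (additive_of G_comm).

HB.instance Definition _ := Choice.on Ga.

Let add_of (x y : Ga) : Ga := ((x : G) * (y : G))%g.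
Let opp_of (x : Ga) : Ga := ((x : G)^-1)%g.

Let addA : associative add_of.
Proof. exact: mulgA. Qed.
Let addC : commutative add_of.
Proof. by move=> x y; exact: G_comm. Qed.
Let add0 : left_id (1%g : Ga) add_of.
Proof. exact: mul1g. Qed.
Let addN : left_inverse (1%g : Ga) opp_of add_of.
Proof. exact: mulVg. Qed.

HB.instance Definition _ := GRing.isZmodule.Build Ga addA addC add0 addN.

Lemma submodule_subgroup (S : set (zmodule Ga)) :
  is_submodule S -> is_subgroup (S : set G).
Proof.
move=> subS; apply/is_subgroupE; split; first exact: submodule0 subS.
by move=> x y Sx Sy; apply: (submoduleB subS Sx Sy).
Qed.

Lemma join_proper_hollow : join_proper G -> hollow (zmodule Ga).
Proof.
move=> G_join S T subS subT STT; apply: contrapT => /not_orP[ST TT].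
have [_] := G_join S T (conj (submodule_subgroup subS) ST)
  (conj (submodule_subgroup subT) TT).
apply; apply/seteqP; split=> // g _.
have [s Ss [t Tt ->]] : sum_set S T g by rewrite STT.
apply: (@subgroupM G _ (s : G) (t : G) (gen_subgroup _)); apply: subset_gen.
  by left.
by right.
Qed.

Lemma commutative_Prufer : join_proper G -> infinite_set [set: G] ->
  exists2 q : nat, prime q & group_isomorphic G (quasi_cyclic q).
Proof. by move=> /join_proper_hollow; exact: hollow_Prufer. Qed.

End Additive.

Theorem theorem2p1 (G : groupType) (R : comNzRingType) (A : grmodType R G)
    (G_infinite : infinite_set [set: G])
    (G_neq_derived : [set: G] <> derived_subgroup G)
    (R_int_or_padic : R = (int : comNzRingType) \/
       exists2 p : nat, prime p & R = (padic_int p : comNzRingType))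
    (A_faithful : cent_group A = [set 1%g])
    (AG_not_artinian : ~ artinian (quot_mod (cent_mod A [set: G])))
    (AH_artinian : forall H : set G, proper_subgroup H ->
       artinian (quot_mod (cent_mod A H))) :
  exists2 q : nat, prime q & group_isomorphic G (quasi_cyclic q).
Proof.
have G_join := artinian_join_proper AG_not_artinian AH_artinian.
have R_tors : artinian_torsion R.
  case: R_int_or_padic => [->|[p p_pr ->]]; first exact: int_artinian_torsion.
  exact: padic_artinian_torsion.
suff G_comm : forall x y : G, commute x y.
  exact: commutative_Prufer G_comm _ _.
have [[x /cyclic_commute //]|G_nc] :=
  pselect (exists x : G, gen [set x] = [set: G]).
have {}G_nc x : gen [set x] <> [set: G] by move=> xT; apply: G_nc; exists x.
exact: artinian_commute R_tors A_faithful AH_artinian.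
Qed.
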